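(* Let $\mathbf{k}=(k_1,\dots,k_m)$ be a tuple of positive integers and let $z_1,\dots,z_m$ be complex numbers satisfying at least one of the following conditions: (i) $|z_1|<1$, $|z_i|\le1$ for $2\le i\le m-1$, and $|z_m|<1$; (ii) $|z_i|\le1$ for $1\le i\le m$, $k_1\ge2$, and $k_m\ge2$. Then $$\sum_{j=0}^{m}(-1)^j\,\mathrm{Li}_{(k_1,\dots,k_j)}(z_1,\dots,z_j)\,\mathrm{Li}^{\star}_{(k_m,k_{m-1},\dots,k_{j+1})}(z_m,z_{m-1},\dots,z_{j+1})=0,$$ where $\mathrm{Li}_{(k_1,\dots,k_j)}(z_1,\dots,z_j)$ is taken to be $1$ when $j=0$, and $\mathrm{Li}^{\star}_{(k_m,\dots,k_{j+1})}(z_m,\dots,z_{j+1})$ is taken to be $1$ when $j=m$.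
   Context: For positive integers $k_1,\dots,k_r$ and complex numbers $z_1,\dots,z_r$ with either ($|z_1|<1$ and $|z_i|\le1$ for $2\le i\le r$) or ($|z_i|\le1$ for all $i$ and $k_1\ge2$), the multiple polylogarithms are the absolutely convergent series $$\mathrm{Li}_{(k_1,\dots,k_r)}(z_1,\dots,z_r)=\sum_{n_1>\cdots>n_r\ge1}\frac{z_1^{n_1}\cdots z_r^{n_r}}{n_1^{k_1}\cdots n_r^{k_r}},\qquad \mathrm{Li}^{\star}_{(k_1,\dots,k_r)}(z_1,\dots,z_r)=\sum_{n_1\ge\cdots\ge n_r\ge1}\frac{z_1^{n_1}\cdots z_r^{n_r}}{n_1^{k_1}\cdots n_r^{k_r}}.$$ *)

(* Defs.v *)
From mathcomp Require Import all_boot all_order all_algebra.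
From mathcomp Require Import finmap complex.
From mathcomp Require Import all_classical all_reals all_analysis.
From mathcomp.analysis.showcase Require summability.

Set Implicit Arguments.
Unset Strict Implicit.
Unset Printing Implicit Defensive.

Import Order.TTheory GRing.Theory Num.Theory.
Import numFieldNormedType.Exports.

Local Open Scope ring_scope.

(* [R[i]] as a numClosedFieldType: it is through this structure that it carries
   the topology of the norm, hence the limit underlying [summability.sum]. *)
Definition C (R : realType) : numClosedFieldType := R[i].

Section MultiplePolylogarithm.
Variable R : realType.

(* Indices are 0-based: k`_0, z`_0, n`_0 stand for k_1, z_1, n_1. *)
Definition polylog_term (k : seq nat) (z : seq (C R)) (n : seq nat) : C R :=
  \prod_(i < size k) (nth 0 z i ^+ nth 0%N n i
                      / (nth 0%N n i)%:R ^+ nth 0%N k i).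

(* n_1 > ... > n_r >= 1 when rel is gtn, n_1 >= ... >= n_r >= 1 when it is geq. *)
Definition polylog_index (rel : rel nat) (r : nat) : pred (seq nat) :=
  fun n => [&& size n == r, sorted rel n & all (leq 1) n].

(* Unordered sums: limits of the finite partial sums along the directed set of
   finite sets of indices, which in R[i] converge exactly when the family is
   absolutely summable. *)
Definition Li (k : seq nat) (z : seq (C R)) : C R :=
  summability.sum (fun n : {n | polylog_index gtn (size k) n} =>
    polylog_term k z (val n)).

Definition LiStar (k : seq nat) (z : seq (C R)) : C R :=
  summability.sum (fun n : {n | polylog_index geq (size k) n} =>
    polylog_term k z (val n)).

(* The empty depth: the only index is the empty tuple, and its term is 1. *)
Lemma sum_depth0 (rel : rel nat) (z : seq (C R)) :
  summability.sum (fun n : {n | polylog_index rel 0 n} =>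
    polylog_term [::] z (val n)) = 1.
Proof.
have h0 : polylog_index rel 0 [::] by [].
pose n0 : {n | polylog_index rel 0 n} := exist _ [::] h0.
have FF := @summability.totally_filter {n | polylog_index rel 0 n}.
rewrite /summability.sum; apply: cvg_lim; first exact: norm_hausdorff.
apply: cvg_near_cst.
exists [fset n0]%fset => //= A /= n0A.
rewrite /summability.partial_sum.
have -> : A = [fset n0]%fset.
  apply/eqP; rewrite eqEfsubset n0A andbT; apply/fsubsetP => x _.
  rewrite inE -val_eqE /=; case: x => /= x /andP[+ _].
  by rewrite size_eq0.
by rewrite big_fset1 /polylog_term /= big_ord0.
Qed.

Lemma Li_nil (z : seq (C R)) : Li [::] z = 1.
Proof. exact: sum_depth0. Qed.

Lemma LiStar_nil (z : seq (C R)) : LiStar [::] z = 1.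
Proof. exact: sum_depth0. Qed.

End MultiplePolylogarithm.

(* Main.v *)
Require Import Defs.
From mathcomp Require Import all_boot all_order all_algebra.
From mathcomp Require Import finmap complex zify ring lra.
From mathcomp Require Import all_classical all_reals all_analysis.
From mathcomp.analysis.showcase Require Import summability.
Import Order.TTheory GRing.Theory Num.Theory.
Import numFieldNormedType.Exports.

Set Implicit Arguments.
Unset Strict Implicit.
Unset Printing Implicit Defensive.

Local Open Scope ring_scope.
Local Open Scope classical_set_scope.

(** Why the theorem is true.  Cut every series off at indices at most N.  The
truncated sums satisfy the alternating identity exactly, and each of them tends
to the corresponding polylogarithm, so the identity passes to the limit.

The truncated identity.  Let letters a stand for the pairs (k_i, z_i), of
weights w_a(n) = z_i^n / n^k_i, and let X_n be the formal sum of w_a(n) a over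
all letters a, in noncommuting letters.  The signed generating series of the
strict sums is E_N = (1 - X_N) ... (1 - X_1), and that of the star sums of
reversed words is H_N = (1 - X_1)^-1 ... (1 - X_N)^-1.  Hence E_N H_N = 1, and
the coefficient of a nonempty word in this product is the alternating sum, which
therefore vanishes ([alt_conv_diag]).  The proof is an induction on N that peels
off the outer factors one at a time ([alt_conv_cons], [alt_conv_rcons]).

Absolute convergence.  Only the weight f of the largest index has to decay
faster than 1/n; the other weights are only bounded by 1/n.  If the tails of f
satisfy f(m) + f(m+1) + ... <= c m f(m), then exchanging the two outermost summations
absorbs one factor 1/m into f at the price of a constant c, so the depth-r
truncated sums are bounded by c^r f(1) ([weighted_harm_le]).  Both
f(n) = 1/n^2 and f(n) = |z|^n with |z| < 1 have such tails; these are the cases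
k_1 >= 2 and |z_1| < 1 of the hypothesis.

The limit.  A family of complex numbers whose finite absolute sums are bounded
has an unordered sum, and this sum is the limit of the finite sums along any
exhausting sequence of finite sets ([sum_exhaustion]); the multi-indices bounded
by N are such a sequence.  In both parts of the hypothesis the conditions on the
first and last letters make all the prefixes and all the reversed suffixes that
occur admissible. *)

(** * Truncated nested sums and their duality *)

(** The sum over N >= n_1 > n_2 > ... (when b is true) or N >= n_1 >= n_2 >= ...
(when b is false) of the product of the w s_i n_i: the subtraction of the
boolean b is what makes the inequalities strict. *)
Fixpoint trunc (K : comNzRingType) (T : Type) (w : T -> nat -> K) (b : bool)
    (s : seq T) (N : nat) : K :=
  if s is p :: s' then \sum_(1 <= n < N.+1) w p n * trunc w b s' (n - b) else 1.

Section Duality.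
Variables (K : comNzRingType) (T : Type) (w : T -> nat -> K).

(** The coefficient of the word s in E_M H_N.  The two bounds are independent
because the induction on the diagonal passes through E_N.+1 H_N. *)
Definition alt_conv (M N : nat) (s : seq T) : K :=
  \sum_(0 <= j < (size s).+1)
    (-1) ^+ j * trunc w true (take j s) M * trunc w false (rev (drop j s)) N.

Lemma truncS b p s N :
  trunc w b (p :: s) N.+1 =
  trunc w b (p :: s) N + w p N.+1 * trunc w b s (N.+1 - b).
Proof. by rewrite /= big_nat_recr. Qed.

Lemma trunc0 b p s : trunc w b (p :: s) 0 = 0.
Proof. by rewrite /= big_geq. Qed.

Lemma alt_conv_nil M N : alt_conv M N [::] = 1.
Proof. by rewrite /alt_conv big_nat1 /= !mulr1. Qed.

(** Coefficientwise form of H_N.+1 = H_N + H_N.+1 X_N.+1: the last letter of s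
comes first in its reversed suffixes, so it carries the largest index. *)
Lemma alt_conv_rcons M N s p :
  alt_conv M N.+1 (rcons s p) =
  alt_conv M N (rcons s p) + w p N.+1 * alt_conv M N.+1 s.
Proof.
rewrite /alt_conv size_rcons !(big_nat_recr (size s).+1) //=.
rewrite !drop_oversize ?size_rcons //= addrAC; congr (_ + _).
rewrite mulr_sumr -big_split /=; apply: eq_big_nat => j /andP[_].
rewrite ltnS => js; rewrite drop_rcons // rev_rcons truncS subn0.
rewrite -cats1 takel_cat //; set A := _ * trunc _ _ (take _ _) _.
by rewrite mulrDr; congr (_ + _); rewrite mulrCA.
Qed.

(** Coefficientwise form of E_M.+1 = (1 - X_M.+1) E_M. *)
Lemma alt_conv_cons M N p s :
  alt_conv M.+1 N (p :: s) =
  alt_conv M N (p :: s) - w p M.+1 * alt_conv M N s.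
Proof.
rewrite /alt_conv [size (p :: s)]/= !(big_nat_recl (size s).+1) //.
rewrite [take 0 _]/= /= -addrA; congr (_ + _).
rewrite mulr_sumr -sumrB; apply: eq_bigr => j _.
rewrite -[\sum_(1 <= n < M.+2) _]/(trunc w true (p :: take j s) M.+1).
rewrite truncS subn1 /=.
rewrite mulrDr mulrDl; congr (_ + _).
by rewrite exprS mulN1r !mulNr; congr (- _); rewrite !mulrA [w _ _ * _]mulrC.
Qed.

(** If E_N H_N = 1 then E_N.+1 H_N = 1 - X_N.+1, so that P = E_N.+1 H_N.+1
satisfies P = 1 - X_N.+1 + P X_N.+1; induction on the length of words then gives
P = 1. *)
Lemma alt_conv_diag N s : alt_conv N N s = (nilp s)%:R.
Proof.
elim: N s => [|N IHN] s.
  case: s => [|q s]; first exact: alt_conv_nil.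
  rewrite /alt_conv big_nat_recl // drop0 big1_seq ?addr0.
    by case/lastP: s => [|s p]; rewrite ?rev_cons ?rev_rcons /= big_geq // mulr0.
  by move=> j _; rewrite [take _ _]/= trunc0 mulr0 mul0r.
elim/last_ind: s => [|s p IHs]; first exact: alt_conv_nil.
rewrite alt_conv_rcons IHs; case: s {IHs} => [|q s] /=;
  rewrite alt_conv_cons !IHN /=.
  by rewrite mulr1 sub0r addNr.
by rewrite /nilp size_rcons !mulr0 subr0 addr0.
Qed.
End Duality.

(** * Bounds on truncated sums *)

Lemma exchange_triangle (V : nmodType) (F : nat -> nat -> V) N :
  \sum_(1 <= n < N) \sum_(1 <= m < n.+1) F n m =
  \sum_(1 <= m < N) \sum_(m <= n < N) F n m.
Proof.
rewrite (eq_big_nat _ _ (F2 := fun n =>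
    \sum_(1 <= m < N | (m < n.+1)%N) F n m)) => [|n /andP[_ nN]]; last first.
  by rewrite (big_nat_widen _ _ N).
rewrite (exchange_big_dep_nat predT) //=; apply: eq_big_nat => m /andP[m0 _].
by rewrite [RHS](big_nat_widenl _ 1) //.
Qed.

Section Bounds.
Variable K : numFieldType.

(** Nested harmonic star sums of depth r: they dominate every truncated sum whose
weights are at most 1/n, strict or not. *)
Definition harm (r N : nat) : K :=
  trunc (fun (_ : unit) n => n%:R^-1) false (nseq r tt) N.

Lemma harmS r N : harm r.+1 N = \sum_(1 <= n < N.+1) n%:R^-1 * harm r n.
Proof. by rewrite /harm /=; apply: eq_bigr => n _; rewrite subn0. Qed.

Lemma harm_ge0 r N : 0 <= harm r N.
Proof.
elim: r N => [|r IHr] N; first by rewrite /harm /= ler01.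
by rewrite harmS sumr_ge0 // => n _; rewrite mulr_ge0 ?invr_ge0 ?ler0n.
Qed.

Lemma le_harm r : {homo harm r : M N / (M <= N)%N >-> M <= N}.
Proof.
case: r => [|r] M N MN; first by rewrite /harm.
rewrite !harmS [leRHS](big_cat_nat _ (n := M.+1)) //= lerDl sumr_ge0 // => n _.
by rewrite mulr_ge0 ?harm_ge0 ?invr_ge0 ?ler0n.
Qed.

Lemma trunc_ge0 (T : eqType) (w : T -> nat -> K) b s N :
  {in s, forall p n, 0 <= w p n} -> 0 <= trunc w b s N.
Proof.
elim: s N => [|p s IHs] N w0 /=; first exact: ler01.
rewrite sumr_ge0 // => n _; rewrite mulr_ge0 ?w0 ?mem_head // IHs // => q qs.
by apply: w0; rewrite inE qs orbT.
Qed.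

Lemma trunc_le_harm (T : eqType) (w : T -> nat -> K) b s N :
  {in s, forall p n, 0 <= w p n} ->
  {in s, forall p n, (0 < n)%N -> w p n <= n%:R^-1} ->
  trunc w b s N <= harm (size s) N.
Proof.
elim: s N => [|p s IHs] N w0 w1 //.
have ps q : q \in s -> q \in p :: s by move=> qs; rewrite inE qs orbT.
rewrite /= harmS; apply: ler_sum_nat => n /andP[n0 _].
apply: ler_pM; first by rewrite w0 ?mem_head.
- by apply: trunc_ge0 => q /ps; exact: w0.
- by rewrite w1 ?mem_head.
apply: (le_trans (y := harm (size s) (n - b))); last first.
  exact: le_harm (leq_subr _ _).
by apply: IHs => q /ps; [exact: w0 | exact: w1].
Qed.

(** Summing over the largest index first turns the weight f(n) 1/m of the two
largest indices into (f(m) + f(m+1) + ...) / m <= c f(m), which is again of the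
same form with one index fewer. *)
Lemma weighted_harm_le (f : nat -> K) (c : K) r N :
  0 <= c -> (forall n, 0 <= f n) ->
  (forall m M, (0 < m)%N -> \sum_(m <= n < M) f n <= c * (m%:R * f m)) ->
  \sum_(1 <= n < N.+1) f n * harm r n <= c ^+ r.+1 * f 1%N.
Proof.
move=> c0 f0 ftail; elim: r => [|r IHr].
  rewrite expr1; under eq_bigr do rewrite /harm /= mulr1.
  by apply: le_trans (ftail _ _ _) _; rewrite // mul1r.
have -> : \sum_(1 <= n < N.+1) f n * harm r.+1 n =
    \sum_(1 <= m < N.+1) (m%:R^-1 * harm r m) * \sum_(m <= n < N.+1) f n.
  under eq_bigr do rewrite harmS mulr_sumr.
  rewrite exchange_triangle; apply: eq_bigr => m _.
  by rewrite mulr_sumr; apply: eq_bigr => n _; rewrite mulrC.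
rewrite exprS -mulrA; apply: le_trans (ler_wpM2l c0 IHr).
rewrite mulr_sumr; apply: ler_sum_nat => m /andP[m0 _].
have mN0 : m%:R != 0 :> K by rewrite pnatr_eq0 -lt0n.
apply: le_trans (ler_wpM2l _ (ftail _ _ m0)) _.
  by rewrite mulr_ge0 ?harm_ge0 ?invr_ge0 ?ler0n.
by rewrite mulrCA mulrACA mulVf // mul1r [harm r m * _]mulrC.
Qed.

(** Telescoping, since 1/n^2 <= 2/n - 2/(n+1). *)
Lemma inv_sqr_tail m M : (0 < m)%N ->
  \sum_(m <= n < M) (n%:R ^- 2 : K) <= 2%:R * (m%:R * m%:R ^- 2).
Proof.
move=> m0; have mN0 : m%:R != 0 :> K by rewrite pnatr_eq0 -lt0n.
have -> : 2%:R * (m%:R * m%:R ^- 2) = 2%:R / m%:R :> K.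
  by rewrite expr2 invfM mulVKf.
have [mM|Mm] := leqP m M; last first.
  by rewrite big_geq 1?ltnW // divr_ge0 ?ler0n.
apply: (le_trans (y := \sum_(m <= n < M)
    (- (2%:R / n.+1%:R) - - (2%:R / n%:R : K)))).
  apply: ler_sum_nat => n /andP[mn _].
  have n0 : 0 < n%:R :> K by rewrite ltr0n (leq_trans m0).
  rewrite opprK addrC -subr_ge0.
  have -> : 2%:R / n%:R - 2%:R / n.+1%:R - n%:R ^- 2
      = (n%:R - 1) / (n%:R ^+ 2 * n.+1%:R) :> K.
    have nS0 : n.+1%:R != 0 :> K by rewrite pnatr_eq0.
    rewrite -[n.+1]addn1 natrD in nS0 *; field.
    by rewrite nS0 (gt_eqF n0).
  by rewrite divr_ge0 ?subr_ge0 ?ler1n ?(leq_trans m0) // mulr_ge0 ?exprn_ge0 ?ler0n.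
by rewrite telescope_sumr // opprK addrC gerBl divr_ge0 ?ler0n.
Qed.

Lemma geometric_tail (q : K) m M : 0 <= q -> q < 1 -> (0 < m)%N ->
  \sum_(m <= n < M) q ^+ n <= (1 - q)^-1 * (m%:R * q ^+ m).
Proof.
move=> q0 q1 m0; have q1' : 0 < 1 - q by rewrite subr_gt0.
rewrite -ler_pdivrMl ?invr_gt0 // invrK.
apply: (le_trans (y := q ^+ m)); last by rewrite ler_peMl ?exprn_ge0 ?ler1n.
have [mM|Mm] := leqP m M; last first.
  by rewrite big_geq 1?ltnW // mulr0 exprn_ge0.
rewrite mulr_sumr (eq_bigr (fun n => - q ^+ n.+1 - - q ^+ n)) => [|n _].
  by rewrite telescope_sumr // opprK addrC gerBl exprn_ge0.
by rewrite exprS; ring.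
Qed.
End Bounds.

(** * Unordered sums of complex families *)

Section UnorderedSums.
Variables (R : realType) (I : choiceType).
Local Existing Instance totally_filter.

Lemma le_partial_sum (K : numDomainType) (y : I -> K) (A A' : {fset I}) :
  (forall i, 0 <= y i) -> (A `<=` A')%fset -> partial_sum y A <= partial_sum y A'.
Proof.
move=> y0 AA'; rewrite /partial_sum -!(big_seq_fsetE _ _ predT y).
rewrite [leRHS](big_fsetID _ (mem A)) /=.
rewrite (_ : [fset x in A' | x \in A]%fset = A); last first.
  apply/fsetP => i; rewrite !inE /= andbC.
  by case: (boolP (i \in A)) => // /(fsubsetP AA').
by rewrite lerDl sumr_ge0.
Qed.

(** The partial sums of a nonnegative family are monotone, so they converge to
their supremum. *)
Lemma cvg_partial_sum_ge0 (y : I -> R) (B : R) :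
  (forall i, 0 <= y i) -> (forall A, partial_sum y A <= B) ->
  cvg (partial_sum y @ totally).
Proof.
move=> y0 yB; pose S := range (partial_sum y).
have S0 : S !=set0 by exists (partial_sum y fset0); exists fset0.
have supS : has_sup S by split=> //; exists B => _ [A _ <-].
apply/cvg_ex; exists (sup S); apply/cvgrPdist_le => e e0.
have [_ [A _ <-] Ae] := sup_adherent e0 supS.
exists A => // A' /= AA'; rewrite ger0_norm.
  by rewrite lerBlDl -lerBlDr (le_trans (ltW Ae)) // le_partial_sum.
by rewrite subr_ge0; apply: ub_le_sup; [case: supS | exists A'].
Qed.

(** The family y is the difference of the nonnegative families y + a and a. *)
Lemma cvg_partial_sum_real (y a : I -> R) (B : R) :
  (forall i, `|y i| <= a i) -> (forall A, partial_sum a A <= B) ->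
  cvg (partial_sum y @ totally).
Proof.
move=> ya aB; have a0 i : 0 <= a i by apply: le_trans (ya i).
have -> : partial_sum y = partial_sum (fun i => y i + a i) \- partial_sum a.
  by apply/funext => A; rewrite /= /partial_sum -sumrB; apply: eq_bigr => i _; ring.
apply: is_cvgB; apply: cvg_partial_sum_ge0.
- by move=> i; have := ya i; rewrite ler_norml => /andP[]; lra.
- move=> A; apply: (le_trans (y := 2 * partial_sum a A)).
    2: exact: (ler_wpM2l _ (aB A)).
  rewrite /partial_sum mulr_sumr; apply: ler_sum => i _.
  by have := ya (val i); rewrite ler_norml => /andP[]; lra.
- by [].
- exact: aB.
Qed.

Lemma Re_sum (A : {fset I}) (x : I -> C R) :
  complex.Re (partial_sum x A) = partial_sum (fun i => complex.Re (x i)) A.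
Proof. by rewrite /partial_sum; apply: big_morph => [[? ?] [? ?]|]. Qed.

Lemma Im_sum (A : {fset I}) (x : I -> C R) :
  complex.Im (partial_sum x A) = partial_sum (fun i => complex.Im (x i)) A.
Proof. by rewrite /partial_sum; apply: big_morph => [[? ?] [? ?]|]. Qed.

Lemma normC_real (r : R) : `|r%:C%C : C R| = `|r|%:C%C.
Proof. by rewrite normc_def /= expr0n addr0 sqrtr_sqr. Qed.

Lemma normC_le_ReIm (u : C R) : `|u| <= (`|complex.Re u| + `|complex.Im u|)%:C%C.
Proof.
rewrite {1}[u]complexE (le_trans (ler_normD _ _)) // normrM.
rewrite (_ : `|'i%C : C R| = 1) ?mul1r; last first.
  by rewrite normc_def /= expr0n expr1n add0r sqrtr1.
by rewrite rmorphD /= !normC_real.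
Qed.

Lemma Re_le_normC (u : C R) : `|complex.Re u| <= complex.Re `|u|.
Proof. by rewrite normc_def /= -sqrtr_sqr ler_wsqrtr // lerDl sqr_ge0. Qed.

Lemma Im_le_normC (u : C R) : `|complex.Im u| <= complex.Re `|u|.
Proof. by rewrite normc_def /= -sqrtr_sqr ler_wsqrtr // lerDr sqr_ge0. Qed.

(** Absolute summability is applied to the real and imaginary parts separately,
so that only the completeness of the real numbers is used. *)
Lemma cvg_partial_sum_normC (x : I -> C R) (B : C R) :
  (forall A, partial_sum (fun i => `|x i|) A <= B) ->
  cvg (partial_sum x @ totally).
Proof.
move=> xB; pose a i := complex.Re `|x i|.
have aB A : partial_sum a A <= complex.Re B.
  by have := xB A; rewrite lecE => /andP[_]; rewrite Re_sum.
have /cvg_ex[u /= xu] := cvg_partial_sum_real (fun i => Re_le_normC (x i)) aB.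
have /cvg_ex[v /= xv] := cvg_partial_sum_real (fun i => Im_le_normC (x i)) aB.
apply: (cvgP ((u +i* v)%C : C R)); apply/cvgrPdist_le => e e0.
have [ie re] : complex.Im e = 0 /\ 0 < complex.Re e.
  by move: e0; rewrite ltcE /= => /andP[/eqP].
have re2 : 0 < complex.Re e / 2 by rewrite divr_gt0.
move/cvgrPdist_le : xu => /(_ _ re2) xu; move/cvgrPdist_le : xv => /(_ _ re2) xv.
apply: filterS2 xu xv => A xu xv; apply: le_trans (normC_le_ReIm _) _.
have -> : e = (complex.Re e)%:C%C by case: e {e0 xu xv re re2} ie => ? ? /= ->.
rewrite lecR.
have -> : complex.Re ((u +i* v)%C - partial_sum x A) =
    u - partial_sum (fun i => complex.Re (x i)) A.
  by rewrite -Re_sum; case: (partial_sum x A).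
have -> : complex.Im ((u +i* v)%C - partial_sum x A) =
    v - partial_sum (fun i => complex.Im (x i)) A.
  by rewrite -Im_sum; case: (partial_sum x A).
by rewrite [leRHS]splitr; apply: lerD.
Qed.

End UnorderedSums.

Section Exhaustion.
Variables (R : realType) (T : choiceType) (P : pred T).
Local Existing Instance totally_filter.

(** The finite sets listed by L are cofinal among all finite sets of indices, so
convergence along the directed set of finite sets specializes to L. *)
Lemma sum_exhaustion (x : T -> C R) (L : nat -> seq T) (B : C R) :
  (forall N, uniq (L N)) -> (forall N, {subset L N <= P}) ->
  (forall t, P t -> \forall N \near \oo, t \in L N) ->
  (forall N, \sum_(t <- L N) `|x t| <= B) ->
  (fun N => \sum_(t <- L N) x t) @ \oo -->
    (sum (fun t : {t | P t} => x (val t)) : C R).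
Proof.
move=> Lu LP Lcover LB.
pose I := {t | P t}.
pose J N : {fset I} := [fset i in (pmap insub (L N) : seq I)]%fset.
have inJ i N : (i \in J N) = (val i \in L N).
  by rewrite inE /= mem_pmap_sub.
have sumJ (V : zmodType) (y : T -> V) N :
    partial_sum (fun i : I => y (val i)) (J N) = \sum_(t <- L N) y t.
  rewrite /partial_sum -(big_seq_fsetE _ _ predT (fun i : I => y (val i))) /=.
  rewrite -(big_map val predT y) /=; apply: perm_big.
  apply: uniq_perm; rewrite ?Lu ?(map_inj_uniq val_inj) ?fset_uniq // => t.
  apply/mapP/idP => [[i iJ ->]|tL]; first by rewrite -inJ.
  by exists (exist _ t (LP _ _ tL)); rewrite ?inJ.
have Jcover (A : {fset I}) : \forall N \near \oo, (A `<=` J N)%fset.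
  have : \forall N \near \oo, forall i : A, val (val i) \in L N.
    by apply: filter_forall => i; apply/Lcover/(valP (val i)).
  apply: filterS => N AL; apply/fsubsetP => i iA.
  by rewrite inJ; exact: (AL [` iA]%fset).
have Jtot : J @ \oo --> (totally : set_system {fset I}).
  by move=> X [A _ AX]; apply: filterS (Jcover A) => N; exact: AX.
have cvgx : cvg (partial_sum (fun i : I => x (val i)) @ totally).
  apply: (@cvg_partial_sum_normC R I _ B) => A.
  have [N _ /(_ N (leqnn N)) AN] := Jcover A.
  apply: (le_trans (le_partial_sum _ AN)) => [i|]; first exact: normr_ge0.
  by rewrite (sumJ _ (fun t => `|x t|)).
have -> : (fun N => \sum_(t <- L N) x t) =
    partial_sum (fun i : I => x (val i)) \o J.
  by apply/funext => N; rewrite /= sumJ.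
exact: cvg_comp Jtot cvgx.
Qed.
End Exhaustion.

(** * Multi-indices with bounded entries *)

Definition chain (b : bool) : rel nat := if b then gtn else geq.

Lemma chainE b x y : (0 < x)%N -> chain b x y = (y <= x - b)%N.
Proof. by case: b x => [] [|x] // _; rewrite /= ?subn1 ?subn0. Qed.

Lemma chain_trans b : transitive (chain b).
Proof.
by case: b => y x z /= yx zy; [exact: ltn_trans zy yx | exact: leq_trans zy yx].
Qed.

(** The multi-indices with entries at most N, listed by the same recursion as
[trunc], which makes the comparison of the sums immediate. *)
Fixpoint chains (b : bool) (r N : nat) : seq (seq nat) :=
  if r is r'.+1 then
    [seq n :: t | n <- index_iota 1 N.+1, t <- chains b r' (n - b)]
  else [:: [::]].

Lemma uniq_chains b r N : uniq (chains b r N).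
Proof.
elim: r N => [|r IHr] N //=; apply: allpairs_uniq_dep => //.
  exact: iota_uniq.
by move=> [x s] [y t] _ _ /= [-> ->].
Qed.

Lemma mem_chains b r N t :
  (t \in chains b r N) = polylog_index (chain b) r t && all (leq^~ N) t.
Proof.
elim: r N t => [|r IHr] N t /=.
  by rewrite inE /polylog_index; case: t.
apply/allpairsPdep/idP => [[n [s [nN sn ->]]]|].
  move: nN sn; rewrite mem_index_iota ltnS => /andP[n0 nN].
  rewrite IHr /polylog_index => /andP[/and3P[/eqP <- ss s0] sn] /=.
  rewrite eqxx n0 s0 nN (path_sortedE (@chain_trans b)) ss !andbT /=.
  apply/andP; split; first by apply: sub_all sn => x; rewrite chainE.
  by apply: sub_all sn => x xn; rewrite (leq_trans xn) // (leq_trans (leq_subr _ _)).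
case: t => // n s; rewrite /polylog_index /= eqSS (path_sortedE (@chain_trans b)).
case/andP=> /and3P[sr /andP[ns ss] /andP[n0 s0]] /andP[nN _].
exists n, s; split => //; first by rewrite mem_index_iota n0.
rewrite IHr /polylog_index sr ss s0 /=.
by apply: sub_all ns => x; rewrite chainE.
Qed.

Lemma take_zip (S T : Type) (s : seq S) (t : seq T) j :
  take j (zip s t) = zip (take j s) (take j t).
Proof. by elim: s t j => [|x s IHs] [|y t] [|j] //=; rewrite IHs. Qed.

Lemma drop_zip (S T : Type) (s : seq S) (t : seq T) j :
  drop j (zip s t) = zip (drop j s) (drop j t).
Proof. by elim: s t j => [|x s IHs] [|y t] [|j] //=; case: (drop j _). Qed.

(** * Polylogarithms as limits of truncated sums *)

Section Polylog.
Variable R : realType.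

Definition weight (p : nat * C R) (n : nat) : C R := p.2 ^+ n / n%:R ^+ p.1.

(** With f = id this is the truncated polylogarithm; with f the norm it gives the
finite sums of absolute values, which decide summability. *)
Lemma sum_chains (f : C R -> C R) b k z N :
  {morph f : x y / x * y} -> f 1 = 1 -> size z = size k ->
  \sum_(t <- chains b (size k) N) f (polylog_term k z t) =
  trunc (fun p n => f (weight p n)) b (zip k z) N.
Proof.
move=> fM f1; elim: k z N => [|k0 k IHk] [|z0 z] N //=.
  by rewrite big_seq1 /polylog_term big_ord0.
move=> [zk]; rewrite big_allpairs_dep /=; apply: eq_bigr => n _.
rewrite -IHk // mulr_sumr; apply: eq_bigr => t _.
by rewrite -fM /polylog_term big_ord_recl.
Qed.

(** The convergence condition of the series.  Since the default head 0 has norm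
less than 1, the last clause holds for the empty word, whose sum is 1. *)
Definition admissible (k : seq nat) (z : seq (C R)) :=
  [/\ size z = size k, all (leq 1) k, all (fun x => `|x| <= 1) z
    & `|head 0 z| < 1 \/ (1 < head 0%N k)%N].

Lemma norm_weight_le q (p : nat * C R) n :
  `|p.2| <= 1 -> (q <= p.1)%N -> (0 < n)%N -> `|weight p n| <= n%:R ^- q.
Proof.
move=> z1 qk n0; have nC0 : 0 < n%:R :> C R by rewrite ltr0n.
rewrite /weight normrM normrX normfV normrX normr_nat.
rewrite -[leRHS]mul1r; apply: ler_pM; rewrite ?invr_ge0 ?exprn_ge0 ?ler0n //.
  by rewrite exprn_ile1.
by rewrite lef_pV2 ?posrE ?exprn_gt0 // ler_weXn2l // ler1n.
Qed.

Lemma norm_weight_le_geometric (p : nat * C R) n :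
  (0 < n)%N -> `|weight p n| <= `|p.2| ^+ n.
Proof.
move=> n0; rewrite /weight normrM normrX normfV normrX normr_nat.
rewrite ler_piMr ?exprn_ge0 //.
by rewrite invf_le1 ?exprn_gt0 ?ltr0n // exprn_ege1 // ler1n.
Qed.

(** The majorant f of the weight of the largest index is the geometric sequence
when |z_1| < 1 and the inverse square when k_1 >= 2. *)
Lemma trunc_norm_bounded k z : admissible k z ->
  exists B, forall b N, trunc (fun p n => `|weight p n|) b (zip k z) N <= B.
Proof.
case: k z => [|k0 k] [|z0 z] [] //; first by exists 1.
move=> [zk] /andP[k0_gt0 k1] /andP[z01 z1] zk0.
have [f [c [c0 f0 wf ftail]]] : exists (f : nat -> C R) (c : C R),
    [/\ 0 <= c, forall n, 0 <= f n,
      forall n, (0 < n)%N -> `|weight (k0, z0) n| <= f n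
    & forall m M, (0 < m)%N -> \sum_(m <= n < M) f n <= c * (m%:R * f m)].
  case: zk0 => [z0lt|k0gt].
    exists (fun n => `|z0| ^+ n), (1 - `|z0|)^-1; split => [|n|n n0|m M m0].
    - by rewrite invr_ge0 subr_ge0.
    - exact: exprn_ge0.
    - exact: (norm_weight_le_geometric (k0, z0)).
    - exact: geometric_tail.
  exists (fun n => n%:R ^- 2), 2%:R; split => [|n|n n0|m M m0].
  - exact: ler0n.
  - by rewrite invr_ge0 exprn_ge0 ?ler0n.
  - exact: norm_weight_le.
  - exact: inv_sqr_tail.
exists (c ^+ (size (zip k z)).+1 * f 1%N) => b N.
apply: le_trans (weighted_harm_le (size (zip k z)) N c0 f0 ftail).
apply: ler_sum_nat => n /andP[n0 _]; apply: ler_pM; rewrite ?wf //.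
  by apply: trunc_ge0 => p _ n'.
apply: (le_trans (y := harm _ (size (zip k z)) (n - b))); last first.
  exact: le_harm (leq_subr _ _).
apply: trunc_le_harm => [p _ n' //|p pkz n' n'0].
rewrite -[n'%:R]expr1; apply: norm_weight_le => //.
  have /(allP z1) : p.2 \in z; last by [].
  by rewrite -(@unzip2_zip _ _ k z) ?zk // map_f.
have /(allP k1) : p.1 \in k; last by [].
by rewrite -(@unzip1_zip _ _ k z) ?zk // map_f.
Qed.

Lemma cvg_trunc b k z : admissible k z ->
  trunc weight b (zip k z) @ \oo -->
  (sum (fun t : {t | polylog_index (chain b) (size k) t} =>
     polylog_term k z (val t)) : C R).
Proof.
move=> kz; have [zk _ _ _] := kz; have [B wB] := trunc_norm_bounded kz.
rewrite (_ : trunc weight b (zip k z) =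
    fun N => \sum_(t <- chains b (size k) N) polylog_term k z t); last first.
  by apply/funext => N; rewrite (sum_chains (f := id)).
apply: (@sum_exhaustion _ _ _ _ _ B) => [N|N t|t tP|N].
- exact: uniq_chains.
- by rewrite mem_chains => /andP[].
- exists (\max_(i <- t) i)%N => // N /= tN; rewrite mem_chains tP /=.
  apply/allP => i it; apply: leq_trans tN.
  exact: (leq_bigmax_seq (F := fun i => i) i it).
- rewrite (sum_chains (f := fun x => `|x|)) ?normr1 //.
  exact: normrM.
Qed.

Lemma cvg_Li k z : admissible k z ->
  trunc weight true (zip k z) @ \oo --> (Li k z : C R).
Proof. exact: (@cvg_trunc true). Qed.

Lemma cvg_LiStar k z : admissible k z ->
  trunc weight false (zip k z) @ \oo --> (LiStar k z : C R).
Proof. exact: (@cvg_trunc false). Qed.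

(** Reversed suffixes are prefixes of the reversed word, so this covers the
arguments of both Li and LiStar. *)
Lemma admissible_take k z j : admissible k z -> admissible (take j k) (take j z).
Proof.
case=> zk k1 z1 h; split.
- by rewrite !size_take zk.
- by apply/allP => x /mem_take /(allP k1).
- by apply/allP => x /mem_take /(allP z1).
- by case: j k z zk h {k1 z1} => [|j] [|k0 k] [|z0 z] //=; rewrite normr0 ltr01; left.
Qed.

End Polylog.

(** * The alternating sum of products *)

Theorem theorem2p13 (R : realType) (m : nat)
    (k : m.-tuple nat) (z : m.-tuple (C R)) :
  (0 < m)%N ->
  (forall i : 'I_m, (0 < tnth k i)%N) ->
  [/\ `|nth 0 z 0| < 1,
      forall i : nat, (0 < i < m.-1)%N -> `|nth 0 z i| <= 1
    & `|nth 0 z m.-1| < 1]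
  \/
  [/\ forall i : 'I_m, `|tnth z i| <= 1,
      (2 <= nth 0%N k 0)%N
    & (2 <= nth 0%N k m.-1)%N] ->
  \sum_(0 <= j < m.+1)
     (-1) ^+ j * Li (take j k) (take j z)
               * LiStar (rev (drop j k)) (rev (drop j z)) = 0.
Proof.
move=> m0 k_gt0 hz.
have z_le1 i : (i < m)%N -> `|nth 0 z i| <= 1.
  move=> im; case: hz => [[z0 zi zm]|[zi _ _]].
    have [->|i0] := posnP i; first exact: ltW.
    have [ilast|lasti] := ltnP i m.-1; first by apply: zi; rewrite i0.
    by rewrite (_ : i = m.-1); [exact: ltW | lia].
  by have := zi (Ordinal im); rewrite (tnth_nth 0).
have k1 : all (leq 1) k by apply/all_tnthP.
have z1 : all (fun x => `|x| <= 1) z.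
  by apply/(all_nthP 0) => i; rewrite size_tuple; exact: z_le1.
have kz : admissible k z.
  split; rewrite ?size_tuple // -!nth0.
  by case: hz => [[? _ _]|[_ ? _]]; [left | right].
have kzr : admissible (rev k) (rev z).
  split; rewrite ?size_rev ?size_tuple ?all_rev // -!nth0 !nth_rev ?size_tuple //.
  by rewrite subn1; case: hz => [[_ _ ?]|[_ _ ?]]; [left | right].
pose s := zip k z; have ss : size s = m by rewrite size_zip !size_tuple minnn.
have cvg0 : (fun N => alt_conv (@weight R) N N s) @ \oo --> (0 : C R).
  apply: cvg_near_cst; apply: nearW => N.
  by rewrite alt_conv_diag /nilp ss; case: (m) m0.
apply: (cvg_unique (@norm_hausdorff _ (C R)) _ cvg0).
rewrite /alt_conv ss; apply: cvg_big => [|j _]; first exact: add_continuous.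
apply: cvgM; first apply: cvgMl_tmp.
  by rewrite take_zip; apply: cvg_Li; exact: admissible_take.
have -> : rev (drop j s) = zip (rev (drop j k)) (rev (drop j z)).
  by rewrite drop_zip rev_zip // !size_drop !size_tuple.
apply: cvg_LiStar.
rewrite !rev_drop !size_tuple.
exact: admissible_take.
Qed.
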